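(* For every rational $\alpha\in(0,\tfrac12)$ and every $\ell\in\mathbb N$ with $\alpha\ell\in\mathbb N$ there is a constant $c_\ell$ (depending only on $\ell$) such that for all sufficiently large $n$ the following holds. Let $J=J_{n,\ell,\alpha}$, let $\pi$ be the uniform distribution on $V(J)$ and $L=I-A$ its normalized Laplacian. For every integer $0\le r\le\ell/2$, there is a degree-2 sum-of-squares proof, in the formal variables $(F(X))_{X\in V(J)}$ and from the axioms $\{0\le F(X)\le1\}_{X\in V(J)}$, of $$\langle F,LF\rangle_\pi\ \ge\ \big(1-(1-\alpha)^{r+1}\big)\Big[\big(1-\tfrac{c_\ell}{n}\big)\mathbb{E}_\pi[F]-8^r\binom{\ell}{r}\sum_{j=0}^r\mathbb{E}_{Y\in\binom{[n]}{j}}\big[\delta_Y(F)^2\big]+\mathbb{E}_\pi[F^2-F]\Big].$$ In particular this inequality holds for every $F:V(J)\to[0,1]$.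
   Context: For $0<\alpha<1$ and $\ell,n\in\mathbb N$ with $\alpha\ell\in\mathbb N$ and $n>\ell$, the Johnson graph $J_{n,\ell,\alpha}$ has vertex set $\binom{[n]}{\ell}$ with $U\sim V$ iff $|U\cap V|=(1-\alpha)\ell$. $A$ is its random-walk transition matrix and $\langle f,g\rangle_\pi=\mathbb{E}_{X\sim\pi}f(X)g(X)$. For $Y\subseteq[n]$ with $|Y|=j\le\ell-1$, $\delta_Y(F)$ is the average of $F$ over the vertices of $J$ containing $Y$, i.e. $\delta_Y(F)=\mathbb{E}_{X\in\binom{[n]\setminus Y}{\ell-j}}F(Y\cup X)$; for $Y=\emptyset$, $\delta_\emptyset(F)=\mathbb{E}_\pi[F]$. A degree-$d$ SoS proof of $g\ge h$ from axioms $\{a_i\ge0\}$ means $g-h=s_0+\sum_i s_i a_i$ with $s_0,s_i$ sums of squares and all terms of degree $\le d$. *)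

(* Defs.v *)
From HB Require Import structures.
From mathcomp Require Import all_boot all_order all_algebra.
From mathcomp Require Import reals.
From mathcomp Require Import mpoly.

Set Implicit Arguments.
Unset Strict Implicit.
Unset Printing Implicit Defensive.

Import Order.TTheory GRing.Theory Num.Theory.
Local Open Scope ring_scope.

Definition vert (n l : nat) := {X : {set 'I_n} | #|X| == l}.

Definition nvert (n l : nat) : nat := #|{: vert n l}|.

Definition jadj (alpha : rat) (n l : nat) (U V : vert n l) : bool :=
  (#|val U :&: val V|%:R == (1 - alpha) * l%:R :> rat).

Section Johnson.
Variables (R : realType) (alpha : rat) (n l : nat).

Local Notation V := (vert n l).
Local Notation N := (nvert n l).
Local Notation P := {mpoly R[N]}.

Definition Fv (X : V) : P := 'X_(enum_rank X).

Definition Epi (G : V -> P) : P :=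
  (#|{: V}|%:R^-1)%:MP * \sum_(X : V) G X.

Definition AF (X : V) : P :=
  (#|[set Y : V | jadj alpha X Y]|%:R^-1)%:MP *
    \sum_(Y : V | jadj alpha X Y) Fv Y.

Definition dirichlet : P := Epi (fun X => Fv X * (Fv X - AF X)).

Definition delta (Y : {set 'I_n}) : P :=
  (#|[set X : V | Y \subset val X]|%:R^-1)%:MP *
    \sum_(X : V | Y \subset val X) Fv X.

Definition Edelta2 (j : nat) : P :=
  (#|[set Y : {set 'I_n} | #|Y| == j]|%:R^-1)%:MP *
    \sum_(Y : {set 'I_n} | #|Y| == j) delta Y ^+ 2.

Definition rhs (c : R) (r : nat) : P :=
  (1 - (1 - ratr alpha) ^+ r.+1)%:MP *
  ( (1 - c / n%:R)%:MP * Epi Fv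
    - (8 ^+ r * 'C(l, r)%:R)%:MP * \sum_(j < r.+1) Edelta2 j
    + Epi (fun X => Fv X ^+ 2 - Fv X) ).

Definition box_axioms : seq P :=
  [seq Fv X | X <- enum {: V}] ++ [seq 1 - Fv X | X <- enum {: V}].

End Johnson.

Arguments rhs : clear implicits.

Definition sos (R : realType) (k : nat) (p : {mpoly R[k]}) : Prop :=
  exists s : seq {mpoly R[k]}, p = \sum_(q <- s) q ^+ 2.

(* degree-d SoS proof of g >= h from axioms {a_i >= 0}:
   g - h = s_0 + sum_i s_i a_i, s_0, s_i SoS, every term of degree <= d
   (msize p = 1 + total degree of p). *)
Definition sos_proof (R : realType) (k d : nat) (ax : seq {mpoly R[k]})
    (g h : {mpoly R[k]}) : Prop :=
  exists (s0 : {mpoly R[k]}) (s : seq {mpoly R[k]}),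
    [/\ size s = size ax,
        sos s0 /\ (forall i : 'I_(size ax), sos s`_i),
        g - h = s0 + \sum_(i < size ax) s`_i * ax`_i,
        (msize s0 <= d.+1)%N
      & forall i : 'I_(size ax), (msize (s`_i * ax`_i) <= d.+1)%N].

(* Main.v *)
Require Import Defs.
From HB Require Import structures.
From mathcomp Require Import all_boot all_order all_algebra.
From mathcomp Require Import reals.
From mathcomp Require Import mpoly.
From mathcomp Require Import all_fingroup ring lra zify.
Import Order.TTheory GRing.Theory Num.Theory.
Local Open Scope ring_scope.

(** The inequality holds with [c = 0] and without the box axioms: the difference of the two sides is
    a sum of squares of linear forms.  Averaging over the symmetric group, every form involved is a
    combination of the correlations [a k = \sum_s F(s U) F(s V)], where [#|U :&: V| = k].  Let
    [N j] be the [j]-th finite difference of [a] at [0]; by Newton's formula the difference of the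
    two sides is [\sum_j q_j N j] (up to squares), with explicit [q_j].  As [n] grows, [N j] tends
    to a multiple of the weight of [F] at level [j]: if [x_1, y_1, .., x_j, y_j] and the blocks
    [R_0, .., R_K] are disjoint, the square of the sum over the blocks of the alternating sum of [F]
    over the sets [{x_1 or y_1, .., x_j or y_j} + R_b] averages to a multiple of
    [K * N j + D^j a (l - j)], so that [N j >= - O(1/K) a l].  For [0 < r] all [q_j] are bounded
    below by a positive constant, while [\sum_j 'C(l, j) N j = a l] exactly, so the errors are
    absorbed.  For [r = 0] one has [q_0 = 0] and [q_1] is not bounded away from [0]; there the
    errors are measured against the second difference [D^2 a (l - 2)], which vanishes at levels
    [0] and [1]. *)

Set Implicit Arguments.
Unset Strict Implicit.
Unset Printing Implicit Defensive.

(** * Finite differences in a convex cone *)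

Definition fdiff (V : zmodType) (a : nat -> V) (t : nat) : V := a t.+1 - a t.

(** Pascal's rule joins the expansions of [a] and [fdiff a]. The sum always runs to [l], so that
    expansions at different [k] can be added termwise. *)
Lemma newton_forward (V : zmodType) (l : nat) (a : nat -> V) (k : nat) : (k <= l)%N ->
  a k = \sum_(i < l.+1) iter i (@fdiff V) a 0%N *+ 'C(k, i).
Proof.
elim: k a => [|k IH] a kl.
  by rewrite big_ord_recl bin0 mulr1n big1 ?addr0.
have -> : a k.+1 = a k + fdiff a k by rewrite /fdiff addrC subrK.
rewrite (IH a (ltnW kl)) (IH (fdiff a) (ltnW kl)).
rewrite [RHS]big_ord_recl [X in X + _ = _]big_ord_recl !bin0 -addrA; congr (_ + _).
rewrite [X in _ + X = _]big_ord_recr /= (bin_small kl) mulr0n addr0 -big_split /=.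
by apply: eq_bigr => i _; rewrite /bump /= add1n binS mulrnDr -iterSr.
Qed.

Lemma bin_le_exp2 (n k : nat) : ('C(n, k) <= 2 ^ n)%N.
Proof.
rewrite -[n]card_ord -cardsT -card_powerset -cards_draws.
by apply: subset_leq_card; apply/subsetP => A; rewrite !inE => /andP[].
Qed.

Section Cone.
Variables (R : realFieldType) (V : lmodType R) (C : V -> Prop).
Hypothesis CD : forall u v, C u -> C v -> C (u + v).
Hypothesis CZ : forall (c : R) u, 0 <= c -> C u -> C (c *: u).
Hypothesis C0 : C 0.

Lemma cone_sum (I : Type) (s : seq I) (P : pred I) (f : I -> V) :
  (forall i, P i -> C (f i)) -> C (\sum_(i <- s | P i) f i).
Proof. by move=> h; apply: (big_ind C). Qed.

Variables (l K : nat) (a : nat -> V).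
Local Notation D j := (iter j (@fdiff V) a).

Hypothesis Dcube : forall j, (j <= l)%N -> C (D j 0%N *+ K + D j (l - j)%N).

Section Base.
Variable s : nat.
Hypothesis sl : (s <= l)%N.
Local Notation b := (D s (l - s)%N).
Hypothesis DsB : forall t, (t <= l - s)%N -> C (b - D s t) /\ C (b + D s t).

(** Reading [C u] as [0 <= u], this is a two-sided bound; each further difference subtracts two
    bounded values, which doubles the bound. *)
Lemma fdiff_bound i t : (t + i <= l - s)%N ->
  C (b *+ 2 ^ i - D (i + s) t) /\ C (b *+ 2 ^ i + D (i + s) t).
Proof.
elim: i t => [|i IH] t ti; first by rewrite expn0 mulr1n; apply: DsB; rewrite addn0 in ti.
have [|h1 h2] := IH t; first lia.
have [|h3 h4] := IH t.+1; first lia.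
rewrite addSn iterS /fdiff expnS mul2n -addnn mulrnDr; split.
  have -> : b *+ 2 ^ i + b *+ 2 ^ i - (D (i + s) t.+1 - D (i + s) t)
    = (b *+ 2 ^ i - D (i + s) t.+1) + (b *+ 2 ^ i + D (i + s) t).
    by rewrite opprB addrACA addrC.
  exact: CD.
by rewrite addrACA; exact: CD.
Qed.

(** [Dcube] bounds the value at [0] from below through the value at [l - (i + s)], which
    [fdiff_bound] in turn bounds by [b]. *)
Lemma fdiff0_bound i : (i + s <= l)%N -> C (D (i + s) 0%N *+ K + b *+ 2 ^ i).
Proof.
move=> h.
have h1 := Dcube h.
have [|h2 _] := @fdiff_bound i (l - (i + s))%N; first lia.
by have := CD h1 h2; rewrite addrACA subrr addr0.
Qed.

Lemma base_cone : C b.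
Proof.
have [_] := DsB (leqnn _).
rewrite -mulr2n -scaler_nat => /(CZ (c := 2^-1)).
by rewrite scalerA mulVf ?pnatr_eq0 // scale1r; apply; rewrite invr_ge0 ler0n.
Qed.

(** This exact expansion lets errors, which are multiples of [b], be paid for by the forms
    [D (i + s) 0] themselves. *)
Lemma base_newton :
  b = \sum_(i < (l - s).+1) 'C(l - s, i)%:R *: D (i + s) 0%N.
Proof.
rewrite {1}(@newton_forward _ (l - s) (D s)) //.
by apply: eq_bigr => i _; rewrite scaler_nat iterD.
Qed.

Lemma nonneg_form (c : nat -> R) (M : R) :
    (forall i, (i <= l - s)%N -> 0 <= c i <= M) ->
  C (K%:R *: \sum_(i < (l - s).+1) c i *: D (i + s) 0%N
     + ((l - s).+1%:R * (M * 2 ^+ l)) *: b).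
Proof.
move=> cM.
have -> : (l - s).+1%:R * (M * 2 ^+ l) = \sum_(i < (l - s).+1) (M * 2 ^+ l) :> R.
  by rewrite sumr_const card_ord mulr_natl.
rewrite scaler_sumr scaler_suml -big_split; apply: cone_sum => -[i /= il] _.
have /andP[c0 cM'] : 0 <= c i <= M by apply: cM.
have h : C (c i *: (D (i + s) 0%N *+ K + b *+ 2 ^ i)).
  by apply: CZ => //; apply: fdiff0_bound; lia.
have -> : K%:R *: (c i *: D (i + s) 0%N) + (M * 2 ^+ l) *: b
   = c i *: (D (i + s) 0%N *+ K + b *+ 2 ^ i) + (M * 2 ^+ l - c i * 2 ^+ i) *: b.
  rewrite scalerDr -!scaler_nat !scalerA natrX -addrA -scalerDl.
  by rewrite [c i * K%:R]mulrC [_ * 2 ^+ i + _]addrC subrK.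
apply: CD => //; apply: CZ; last exact: base_cone.
rewrite subr_ge0; apply: ler_pM => //; first exact: exprn_ge0.
by apply: ler_weXn2l; [lra|lia].
Qed.

(** Subtracting [eta] times [base_newton] leaves coefficients in [[0, M]], to which [nonneg_form]
    applies. Half of the released [eta *: b] pays its error divided by [K]; the other half is the
    surplus in the conclusion. *)
Lemma positive_form (q : nat -> R) (e M : R) :
    (0 < K)%N -> 0 < e -> (forall i, (i <= l - s)%N -> e <= q i <= M) ->
    l.+1%:R * M * 2 ^+ l * 2 ^+ l.+1 <= K%:R * e ->
  C (\sum_(i < (l - s).+1) q i *: D (i + s) 0%N - (e / 2 ^+ l.+1) *: b).
Proof.
move=> K0 e0 qM big.
have p2 : (0 : R) < 2 ^+ l by apply: exprn_gt0.
have M0 : 0 <= M by have := qM 0%N isT; move: e0 => /ltW; lra.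
pose eta := e / 2 ^+ l.
pose c i := q i - eta * 'C(l - s, i)%:R.
have /nonneg_form cC : forall i, (i <= l - s)%N -> 0 <= c i <= M.
  move=> i il; have := qM i il => /andP[qe qm].
  have eta0 : 0 <= eta by rewrite divr_ge0 // ltW.
  have u0 : 0 <= eta * 'C(l - s, i)%:R by rewrite mulr_ge0.
  have u1 : eta * 'C(l - s, i)%:R <= e.
    rewrite /eta mulrAC ler_pdivrMr // ler_pM2l // -natrX ler_nat.
    by apply: leq_trans (bin_le_exp2 _ _) _; rewrite leq_exp2l //; lia.
  by rewrite /c; apply/andP; split; lra.
have -> : \sum_(i < (l - s).+1) q i *: D (i + s) 0%N
   = \sum_(i < (l - s).+1) c i *: D (i + s) 0%N + eta *: b.
  rewrite base_newton scaler_sumr -big_split; apply: eq_bigr => i _ /=.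
  by rewrite scalerA -scalerDl /c subrK.
set S := (X in X + _ - _); set E := (X in X *: b) in cC.
rewrite -addrA -scalerBl.
have -> : S + (eta - e / 2 ^+ l.+1) *: b =
   K%:R^-1 *: ((K%:R *: S + E *: b) + (K%:R * (eta - e / 2 ^+ l.+1) - E) *: b).
  rewrite -addrA -scalerDl [E + _]addrC subrK scalerDr !scalerA mulrA.
  by rewrite mulVf ?pnatr_eq0 -?lt0n // mul1r scale1r.
apply: CZ; first by rewrite invr_ge0.
apply: CD; first exact: cC.
apply: CZ; last exact: base_cone.
rewrite subr_ge0.
have -> : eta - e / 2 ^+ l.+1 = e / 2 ^+ l.+1 by rewrite /eta exprS; field; rewrite gt_eqF.
rewrite mulrA ler_pdivlMr ?exprn_gt0 //; apply: le_trans big.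
rewrite ler_pM2r ?exprn_gt0 // /E mulrA ler_pM2r //.
by apply: ler_wpM2r; rewrite // ler_nat; lia.
Qed.
End Base.

(* Level 1 is compared with second differences: [D^1 a] varies by sums of terms [D^2 a u]. *)
Lemma fdiff1_bound : (2 <= l)%N ->
    (forall t, (t <= l - 2)%N -> C (D 2 (l - 2)%N - D 2 t)) ->
  C (D 1 0%N *+ K.+1 + D 2 (l - 2)%N *+ l.-1).
Proof.
move=> l2 h.
have h1 : C (D 1 0%N *+ K + D 1 (l - 1)%N) by apply: Dcube; lia.
have h2 : C (\sum_(0 <= u < l - 1) (D 2 (l - 2)%N - D 2 u)).
  by rewrite big_mkord; apply: cone_sum => -[u /= ul] _; apply: h; lia.
have := CD h1 h2; rewrite sumrB sumr_const_nat subn0.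
rewrite (_ : \sum_(0 <= u < l - 1) D 2 u = D 1 (l - 1)%N - D 1 0%N); last first.
  by rewrite -telescope_sumr.
by rewrite opprB addrACA subrKC addrAC -mulrSr subn1.
Qed.

(** The terms from index 2 on fall under [positive_form] with [s = 2]; its surplus multiple of [b]
    pays for the error of [fdiff1_bound] at index 1. *)
Lemma positive_form2 (q : nat -> R) (e M : R) :
    (2 <= l)%N -> (forall t, (t <= l - 2)%N ->
      C (D 2 (l - 2)%N - D 2 t) /\ C (D 2 (l - 2)%N + D 2 t)) ->
    (0 < K)%N -> 0 < e ->
    q 0%N = 0 -> 0 <= q 1%N <= M ->
    (forall i, (2 <= i <= l)%N -> e <= q i <= M) ->
    l.+1%:R * M * 2 ^+ l * 2 ^+ l.+1 <= K%:R * e ->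
  C (\sum_(i < l.+1) q i *: D i 0%N).
Proof.
move=> l2 h K0 e0 q0 /andP[q10 q1M] qM big.
have h1 := fdiff1_bound l2 (fun t tl => (h t tl).1).
have h2 := @positive_form 2 l2 h (fun i => q (i + 2)%N) e M K0 e0.
have {}h2 := h2 (fun i il => qM (i + 2)%N ltac:(lia)) big.
have bC := base_cone h.
set b := D 2 (l - 2)%N in h1 h2 bC.
have -> : \sum_(i < l.+1) q i *: D i 0%N =
   q 1%N *: D 1 0%N + \sum_(i < (l - 2).+1) q (i + 2)%N *: D (i + 2) 0%N.
  rewrite -!(big_mkord xpredT (fun i => q i *: D i 0%N)).
  rewrite big_ltn // q0 scale0r add0r big_ltn; last lia. congr (_ + _).
  by rewrite -{1}[2%N]add0n big_addn big_mkord (_ : (l.+1 - 2 = (l - 2).+1)%N); last lia.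
set S := \sum_(i < _) _ in h2 *.
have -> : q 1%N *: D 1 0%N + S =
   (q 1%N / K.+1%:R) *: (D 1 0%N *+ K.+1 + b *+ l.-1) + (S - (e / 2 ^+ l.+1) *: b)
   + (e / 2 ^+ l.+1 - (q 1%N / K.+1%:R) * l.-1%:R) *: b.
  move: (D 1 0%N) => N1; rewrite scalerDr -(scaler_nat K.+1 N1) -(scaler_nat l.-1 b) !scalerA.
  rewrite divfK ?pnatr_eq0 // scalerBl.
  by rewrite -addrA subrKA addrACA subrr addr0.
apply: CD; first by apply: CD => //; apply: CZ => //; rewrite divr_ge0.
apply: CZ => //; rewrite subr_ge0 mulrAC ler_pdivrMr ?ltr0n // mulrAC ler_pdivlMr ?exprn_gt0 //.
apply: le_trans (_ : K%:R * e <= _); last by rewrite mulrC ler_pM2l // ler_nat.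
apply: le_trans big; rewrite ler_pM2r ?exprn_gt0 //.
have p1 : (1 : R) <= 2 ^+ l by apply: exprn_ege1; lra.
have M0 : 0 <= M by lra.
apply: le_trans (_ : l.+1%:R * M <= _); last by rewrite ler_peMr // mulr_ge0.
by rewrite mulrC; apply: ler_pM => //; rewrite ler_nat; lia.
Qed.
End Cone.

(** * Correlations averaged over the symmetric group *)

(** Equal fibre sizes make the two lists of colours rearrangements of each other. *)
Lemma perm_of_card_fibers (n : nat) (C : finType) (c c' : 'I_n -> C) :
    (forall k, #|[set i | c i == k]| = #|[set i | c' i == k]|) ->
  exists s : {perm 'I_n}, forall i, c (s i) = c' i.
Proof.
move=> h.
have hperm : perm_eq [seq c' i | i <- enum 'I_n] [tuple c i | i < n].
  have E (f : 'I_n -> C) k : count_mem k [seq f i | i <- enum 'I_n] = #|[set i | f i == k]|.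
    by rewrite count_map cardsE cardE -size_filter enumT; congr size; apply: eq_filter.
  apply/allP => k _; apply/eqP.
  by rewrite /= E -h -E.
have [s /= es] := tuple_permP hperm.
exists s => i; have := congr1 (fun t => nth (c' i) t i) es.
rewrite -[X in nth _ X _ = _]/(map _ _) (nth_map i) ?size_enum_ord // nth_ord_enum => ->.
rewrite (nth_map i) ?size_enum_ord // nth_ord_enum.
by rewrite (tnth_nth (c' i)) /= (nth_map i) ?size_enum_ord // nth_ord_enum.
Qed.

(** Colour each point by its membership in the two sets: the three cardinals determine the sizes of
    the four colour classes. *)
Lemma perm_pair_transitive (n : nat) (U V U' V' : {set 'I_n}) :
    #|U| = #|U'| -> #|V| = #|V'| -> #|U :&: V| = #|U' :&: V'| ->
  exists s : {perm 'I_n}, s @: U = U' /\ s @: V = V'.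
Proof.
move=> eU eV eI.
pose c (A B : {set 'I_n}) i := (i \in A, i \in B).
have [[b1 b2]|s es] := @perm_of_card_fibers n _ (c U' V') (c U V).
  have D A B : [set i | c A B i == (b1, b2)] =
    (if b1 then A else ~: A) :&: (if b2 then B else ~: B).
    apply/setP => i; rewrite !inE /c xpair_eqE.
    by case: b1 b2 => -[] /=; rewrite ?inE ?eqb_id ?eqbF_neg.
  rewrite !D.
  have cI (A B : {set 'I_n}) : #|A :&: ~: B| = (#|A| - #|A :&: B|)%N.
    by rewrite -setDE cardsD.
  have cC (A : {set 'I_n}) : #|~: A| = (n - #|A|)%N.
    by have := cardsC A; rewrite card_ord; lia.
  case: b1 b2 {D} => -[] //.
  - by rewrite !cI eU eI.
  - by rewrite ![~: _ :&: _]setIC !cI ![_ :&: U]setIC ![_ :&: U']setIC eV eI.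
  - by rewrite -!setCU !cC !cardsU eU eV eI.
exists s; split; apply/setP => i.
- rewrite -[i](permKV s) (mem_imset _ _ (@perm_inj _ s)).
  by have := es ((s^-1)%g i); rewrite /c => -[].
- rewrite -[i](permKV s) (mem_imset _ _ (@perm_inj _ s)).
  by have := es ((s^-1)%g i); rewrite /c => -[].
Qed.

Section PairSums.
Variables (n l : nat) (W : comNzRingType) (F : {set 'I_n} -> W).

Definition pairsum (U V : {set 'I_n}) : W :=
  \sum_(s : {perm 'I_n}) F (s @: U) * F (s @: V).

(* Any pair of [l]-sets meeting in [k] points gives the same value, see [pairsumE]; it is [0] when
   there is no such pair. *)
Definition paircor (k : nat) : W :=
  if [pick p : {set 'I_n} * {set 'I_n} |
      [&& #|p.1| == l, #|p.2| == l & #|p.1 :&: p.2| == k]] is Some p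
  then pairsum p.1 p.2 else 0.

Lemma imset_permM (s t : {perm 'I_n}) (A : {set 'I_n}) : (s * t)%g @: A = t @: (s @: A).
Proof. by rewrite -imset_comp; apply: eq_imset => i; rewrite /= permM. Qed.

Lemma pairsumE (U V : {set 'I_n}) : #|U| = l -> #|V| = l ->
  pairsum U V = paircor #|U :&: V|.
Proof.
move=> cU cV; rewrite /paircor; case: pickP => [[U' V'] /= /and3P[]|].
  move=> /eqP cU' /eqP cV' /eqP cI.
  have [t [<- <-]] : exists t : {perm 'I_n}, t @: U = U' /\ t @: V = V'.
    by apply: perm_pair_transitive; rewrite ?cU ?cV ?cU' ?cV' ?cI.
  rewrite /pairsum (reindex_inj (mulgI t)) /=.
  by apply: eq_bigr => s _; rewrite !imset_permM.
by move=> /(_ (U, V)); rewrite /= cU cV !eqxx.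
Qed.

(** The mixed difference of [G] over the cube of choices of one point from each pair; each choice of
    a second point contributes a sign. *)
Fixpoint cubediff (xs : seq ('I_n * 'I_n)) (G : {set 'I_n} -> W) (A : {set 'I_n}) : W :=
  if xs is p :: xs' then cubediff xs' G (p.1 |: A) - cubediff xs' G (p.2 |: A)
  else G A.

Definition cubepts (xs : seq ('I_n * 'I_n)) : seq 'I_n :=
  flatten [seq [:: p.1; p.2] | p <- xs].

(** Expanding one pair in both factors gives four terms: equal choices add a common point, different
    choices do not. Each pair thus contributes one [fdiff] and a factor 2. *)
Lemma cubediff_pairsum (xs : seq ('I_n * 'I_n)) (A B : {set 'I_n}) :
    uniq (cubepts xs) -> {in cubepts xs, forall i, i \notin A} ->
    {in cubepts xs, forall i, i \notin B} ->
    (#|A| + size xs = l)%N -> (#|B| + size xs = l)%N ->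
  \sum_(s : {perm 'I_n}) cubediff xs (fun X => F (s @: X)) A
      * cubediff xs (fun X => F (s @: X)) B
  = iter (size xs) (@fdiff W) paircor #|A :&: B| *+ 2 ^ size xs.
Proof.
elim: xs A B => [|[x y] xs IH] A B /=.
  by move=> _ _ _; rewrite !addn0 mulr1n => cA cB; rewrite -pairsumE.
rewrite inE negb_or -andbA => /and4P[xy xN yN un] hA hB cA cB.
have [xA yA] : x \notin A /\ y \notin A by split; apply: hA; rewrite !inE eqxx ?orbT.
have [xB yB] : x \notin B /\ y \notin B by split; apply: hB; rewrite !inE eqxx ?orbT.
have step z (D : {set 'I_n}) : z \notin cubepts xs ->
    {in [:: x, y & cubepts xs], forall i, i \notin D} ->
    {in cubepts xs, forall i, i \notin z |: D}.
  move=> zN hD i ixs; rewrite !inE negb_or hD ?inE ?ixs ?orbT // andbT.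
  by apply: contraNneq zN => <-.
have IH' z w : z \notin cubepts xs -> w \notin cubepts xs ->
    z \notin A -> w \notin B ->
  \sum_(s : {perm 'I_n}) cubediff xs (fun X => F (s @: X)) (z |: A)
      * cubediff xs (fun X => F (s @: X)) (w |: B)
  = iter (size xs) (@fdiff W) paircor #|(z |: A) :&: (w |: B)| *+ 2 ^ size xs.
  move=> zN wN zA wB; apply: IH => //; try exact: step.
  - by rewrite cardsU1 zA -cA addnS.
  - by rewrite cardsU1 wB -cB addnS.
have same z : z \notin A -> z \notin B -> #|(z |: A) :&: (z |: B)| = #|A :&: B|.+1.
  by move=> zA zB; rewrite -setUIr cardsU1 !inE (negPf zA).
have diff z w : z != w -> z \notin B -> w \notin A ->
    #|(z |: A) :&: (w |: B)| = #|A :&: B|.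
  move=> zw zB wA; congr #|pred_of_set _|; apply/setP => i; rewrite !inE.
  case: (eqVneq i z) => [->|_]; first by rewrite (negPf zw) (negPf zB) andbF.
  by case: (eqVneq i w) => [->|_] //; rewrite (negPf wA).
under eq_bigr => s _ do rewrite mulrBl !mulrBr.
rewrite !sumrB !IH' // !same // !diff // 1?eq_sym //.
rewrite expnS mulnC mulrnA mulr2n /fdiff -!mulrnBl.
by rewrite -mulrnDl opprB.
Qed.
End PairSums.

(** * Sums of squares of linear forms *)

Section LinearSquares.
Variables (R : realType) (k : nat).
Implicit Types p q : {mpoly R[k]}.

(** Bounding the degree of each root, rather than of the sum, keeps the degree of the certificate
    under control in all cone operations. *)
Definition linsos p : Prop :=
  exists2 s : seq {mpoly R[k]}, all (fun q => (msize q <= 2)%N) s & p = \sum_(q <- s) q ^+ 2.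

Lemma linsos0 : linsos 0.
Proof. by exists [::]; rewrite ?big_nil. Qed.

Lemma linsosD p q : linsos p -> linsos q -> linsos (p + q).
Proof. by move=> [s hs ->] [t ht ->]; exists (s ++ t); rewrite ?all_cat ?hs ?big_cat. Qed.

Lemma linsosZ (c : R) p : 0 <= c -> linsos p -> linsos (c *: p).
Proof.
move=> c0 [s hs ->]; exists [seq Num.sqrt c *: q | q <- s].
  rewrite all_map; apply: sub_all hs => q /= hq.
  exact: leq_trans (msizeZ_le _ _) hq.
by rewrite big_map scaler_sumr; apply: eq_bigr => q _; rewrite exprZn sqr_sqrtr.
Qed.

Lemma linsos_sqr p : (msize p <= 2)%N -> linsos (p ^+ 2).
Proof. by move=> hp; exists [:: p]; rewrite /= ?hp ?big_seq1. Qed.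

Lemma linsos_sum_sqr (I : Type) (r : seq I) (P : pred I) (f : I -> {mpoly R[k]}) :
  (forall i, P i -> (msize (f i) <= 2)%N) -> linsos (\sum_(i <- r | P i) f i ^+ 2).
Proof.
by move=> h; apply: (cone_sum linsosD linsos0) => i /h; exact: linsos_sqr.
Qed.

Lemma msizeB_le2 p q : (msize p <= 2)%N -> (msize q <= 2)%N -> (msize (p - q) <= 2)%N.
Proof.
by move=> hp hq; apply: leq_trans (msizeD_le _ _) _; rewrite msizeN geq_max hp.
Qed.

Lemma msize_sum_le2 (I : Type) (r : seq I) (P : pred I) (f : I -> {mpoly R[k]}) :
  (forall i, P i -> (msize (f i) <= 2)%N) -> (msize (\sum_(i <- r | P i) f i)%R <= 2)%N.
Proof.
move=> h; apply: (big_ind (fun p => msize p <= 2)%N) => //; first by rewrite msize0.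
by move=> p q hp hq; apply: leq_trans (msizeD_le _ _) _; rewrite geq_max hp.
Qed.

Lemma linsos_mulrn (c : nat) p : (0 < c)%N -> linsos (p *+ c) -> linsos p.
Proof.
move=> c0 /(linsosZ (c := c%:R^-1)); rewrite -scaler_nat scalerA mulVf ?scale1r.
  by apply; rewrite invr_ge0.
by rewrite pnatr_eq0 -lt0n.
Qed.

Section CubeForms.
Variables (n l : nat) (F : {set 'I_n} -> {mpoly R[k]}).
Hypothesis F_lin : forall A, (msize (F A) <= 2)%N.
Local Notation a := (paircor l F).
Local Notation D j := (iter j (@fdiff _) a).

Lemma msize_cubediff xs (G : {set 'I_n} -> {mpoly R[k]}) A :
  (forall B, (msize (G B) <= 2)%N) -> (msize (cubediff xs G A) <= 2)%N.
Proof.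
by move=> hG; elim: xs A => [|p xs IH] A //=; exact: msizeB_le2.
Qed.

Definition ordint (u m : nat) : {set 'I_n} := [set i : 'I_n | (u <= i < u + m)%N].

Lemma card_ordint u m : (u + m <= n)%N -> #|ordint u m| = m.
Proof.
elim: m => [|m IH] h.
  by apply/eqP; rewrite cards_eq0; apply/eqP/setP => i; rewrite !inE; lia.
have um : (u + m < n)%N by lia.
rewrite (_ : ordint u m.+1 = Ordinal um |: ordint u m); last first.
  by apply/setP => i; rewrite !inE -val_eqE /=; lia.
by rewrite cardsU1 IH ?inE /=; lia.
Qed.

Lemma cubepts_exist s : (2 * s <= n)%N ->
  exists xs : seq ('I_n * 'I_n), [/\ size xs = s, uniq (cubepts xs) &
    forall i, i \in cubepts xs -> (i < 2 * s)%N].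
Proof.
elim: s => [|s IH] h; first by exists [::].
have [|xs [sx ux lx]] := IH; first lia.
have h0 : (2 * s < n)%N by lia.
have h1 : ((2 * s).+1 < n)%N by lia.
exists ((Ordinal h0, Ordinal h1) :: xs); split => /=; first by rewrite sx.
  rewrite ux inE negb_or andbT -andbA -!val_eqE /=; apply/and3P; split; first by lia.
    by apply/negP => /lx /=; lia.
  by apply/negP => /lx /=; lia.
by move=> i; rewrite !inE => /or3P[/eqP->|/eqP->|/lx] /=; lia.
Qed.

(** The squares of [g A - g B] and [g A + g B] are summed over permutations: the diagonal terms give
    the value at [l - s], the cross term the value at [t]. *)
Lemma linsos_fdiff_top s t : (s <= l)%N -> (t <= l - s)%N -> (2 * s + 2 * l <= n)%N ->
  linsos (D s (l - s)%N - D s t) /\ linsos (D s (l - s)%N + D s t).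
Proof.
move=> sl tl hn.
have [|xs [sx ux lx]] := @cubepts_exist s; first lia.
(* Both intervals avoid the [2 * s] points of the cube, and the shift by [l - s - t] leaves an
   overlap of exactly [t] points. *)
pose A := ordint (2 * s) (l - s); pose B := ordint (2 * s + (l - s - t)) (l - s).
have cA : #|A| = (l - s)%N by rewrite card_ordint //; lia.
have cB : #|B| = (l - s)%N by rewrite card_ordint //; lia.
have cAB : #|A :&: B| = t.
  rewrite (_ : A :&: B = ordint (2 * s + (l - s - t)) t); first by rewrite card_ordint //; lia.
  by apply/setP => i; rewrite !inE; lia.
have nA : {in cubepts xs, forall i, i \notin A} by move=> i /lx; rewrite inE; lia.
have nB : {in cubepts xs, forall i, i \notin B} by move=> i /lx; rewrite inE; lia.
pose g X (s : {perm 'I_n}) := cubediff xs (fun Y => F (s @: Y)) X.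
have g2 X s' : (msize (g X s') <= 2)%N by apply: msize_cubediff.
have sA : (#|A| + size xs = l)%N by rewrite cA sx subnK.
have sB : (#|B| + size xs = l)%N by rewrite cB sx subnK.
have gAA := cubediff_pairsum F ux nA nA sA sA.
have gAB := cubediff_pairsum F ux nA nB sA sB.
have gBB := cubediff_pairsum F ux nB nB sB sB.
rewrite setIid cA sx in gAA; rewrite cAB sx in gAB; rewrite setIid cB sx in gBB.
have c0 : (0 < 2 * 2 ^ s)%N by rewrite muln_gt0 expn_gt0.
split; apply: (linsos_mulrn c0); rewrite mulnC mulrnA.
- have -> : (D s (l - s)%N - D s t) *+ 2 ^ s *+ 2 = \sum_s' (g A s' - g B s') ^+ 2.
    under [RHS]eq_bigr => s' _ do rewrite sqrrB !expr2.
    rewrite big_split sumrB /= sumrMnl.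
    by rewrite gAA gAB gBB mulrnBl mulrnBl mulr2n addrAC.
  by apply: linsos_sum_sqr => s' _; exact: msizeB_le2.
- have -> : (D s (l - s)%N + D s t) *+ 2 ^ s *+ 2 = \sum_s' (g A s' + g B s') ^+ 2.
    under [RHS]eq_bigr => s' _ do rewrite sqrrD !expr2.
    rewrite big_split big_split /= sumrMnl.
    by rewrite gAA gAB gBB mulrnDl mulrnDl mulr2n addrAC.
  apply: linsos_sum_sqr => s' _; rewrite -[g B s']opprK; apply: msizeB_le2 => //.
  by rewrite msizeN.
Qed.

(** In the square of a sum over [K.+1] disjoint blocks, the diagonal gives [K.+1] terms at [l - j]
    and the rest [K.+1 * K] terms at [0]. *)
Lemma linsos_fdiff_blocks K j : (j <= l)%N -> (2 * l + K.+1 * l <= n)%N ->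
  linsos (D j 0%N *+ K + D j (l - j)%N).
Proof.
move=> jl hn.
have [|xs [sx ux lx]] := @cubepts_exist j; first lia.
pose A (b : 'I_K.+1) := ordint (2 * j + b * (l - j)) (l - j).
have inside (b : 'I_K.+1) : (2 * j + b * (l - j) + (l - j) <= n)%N.
  apply: leq_trans hn; rewrite -addnA -mulSnr.
  by apply: leq_add; rewrite ?leq_mul2l ?jl ?orbT //; apply: leq_mul; rewrite ?leq_subr.
have cA b : #|A b| = (l - j)%N by rewrite card_ordint.
have cAB b c : b != c -> #|A b :&: A c| = 0%N.
  move=> bc; apply/eqP; rewrite cards_eq0; apply/eqP/setP => i; rewrite !inE.
  apply/negP => /andP[] /andP[h1 h2] /andP[h3 h4].
  have : val b != val c by [].
  rewrite neq_ltn => /orP[] h.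
  - have : (b.+1 * (l - j) <= c * (l - j))%N by apply: leq_mul.
    rewrite mulSnr => h5.
    by have := leq_ltn_trans h3 h2; rewrite -addnA ltn_add2l ltnNge h5.
  - have : (c.+1 * (l - j) <= b * (l - j))%N by apply: leq_mul.
    rewrite mulSnr => h5.
    by have := leq_ltn_trans h1 h4; rewrite -addnA ltn_add2l ltnNge h5.
have nA b : {in cubepts xs, forall i, i \notin A b}.
  by move=> i /lx h; rewrite inE negb_and -ltnNge (leq_trans h) // leq_addr.
pose g X (s : {perm 'I_n}) := cubediff xs (fun Y => F (s @: Y)) X.
have sA b : (#|A b| + size xs = l)%N by rewrite cA sx subnK.
have gAB b c := cubediff_pairsum F ux (nA b) (nA c) (sA b) (sA c).
rewrite sx in gAB.
have c0 : (0 < K.+1 * 2 ^ j)%N by rewrite muln_gt0 expn_gt0.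
apply: (linsos_mulrn c0); rewrite mulnC mulrnA.
have -> : (D j 0%N *+ K + D j (l - j)%N) *+ 2 ^ j *+ K.+1
    = \sum_s (\sum_(b < K.+1) g (A b) s) ^+ 2.
  under [RHS]eq_bigr => s _.
    rewrite expr2 big_distrl /=.
    under eq_bigr => b _ do rewrite big_distrr /=.
    over.
  rewrite exchange_big /=.
  under [RHS]eq_bigr => b _.
    rewrite exchange_big /=.
    under eq_bigr => c _ do rewrite gAB.
    rewrite (bigD1 b) //= setIid cA.
    under eq_bigr => c cb do rewrite cAB 1?eq_sym //.
    rewrite sumr_const -[#|_|]/#|predC1 b| cardC1 card_ord /=.
    over.
  rewrite sumr_const card_ord; congr (_ *+ _).
  by rewrite mulrnDl addrC mulrnAC.
apply: linsos_sum_sqr => s _; apply: msize_sum_le2 => b _; exact: msize_cubediff.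
Qed.
End CubeForms.
End LinearSquares.

(** * The forms on the Johnson graph *)

Lemma subset_of_card (T : finType) (B : {set T}) (k : nat) :
  (k <= #|B|)%N -> exists2 A : {set T}, A \subset B & #|A| = k.
Proof.
rewrite -bin_gt0 -cards_draws card_gt0 => /set0Pn[A].
by rewrite inE => /andP[AB /eqP cA]; exists A.
Qed.

Lemma mean_bounds (R : realFieldType) (T : finType) (P : pred T) (f : T -> R) (u v : R) :
    (0 < #|[set x | P x]|)%N -> (forall x, P x -> u <= f x <= v) ->
  u <= #|[set x | P x]|%:R^-1 * \sum_(x | P x) f x <= v.
Proof.
move=> c0 h; rewrite ler_pdivlMl ?ltr0n // ler_pdivrMl ?ltr0n //.
have E w : #|[set x | P x]|%:R * w = \sum_(x | P x) w.
  by rewrite sumr_const cardsE mulr_natl.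
by rewrite !E; apply/andP; split; apply: ler_sum => x /h /andP[].
Qed.

Section JohnsonForms.
Variables (R : realType) (n l : nat).
Hypothesis ln : (2 * l <= n)%N.
Local Notation V := (vert n l).
Local Notation P := {mpoly R[nvert n l]}.
Local Notation X_ := (@Fv R n l).

(** Extended by [0] to sets of other sizes, because the correlations are stated for functions on all
    sets. *)
Definition setvar (A : {set 'I_n}) : P := oapp X_ 0 (insub A).

Lemma setvar_val (X : V) : setvar (val X) = X_ X.
Proof. by rewrite /setvar valK. Qed.

Lemma card_val (X : V) : #|val X| = l.
Proof. exact/eqP/(valP X). Qed.

Lemma card_valI (X Y : V) : (#|val X :&: val Y| <= l)%N.
Proof. by have := subset_leq_card (subsetIl (val X) (val Y)); rewrite card_val. Qed.

Lemma msize_Fv (X : V) : msize (X_ X) = 2%N.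
Proof. by rewrite msizeX mdeg1. Qed.

Lemma msize_setvar A : (msize (setvar A) <= 2)%N.
Proof. by rewrite /setvar; case: insubP => [X _ _|_] /=; rewrite ?msize_Fv ?msize0. Qed.

Local Notation a := (paircor l setvar).
Local Notation D j := (iter j (@fdiff _) a).

Lemma card_vact (s : {perm 'I_n}) (X : V) : #|s @: val X| == l.
Proof. by rewrite card_imset ?(valP X) //; exact: perm_inj. Qed.

Definition vact (s : {perm 'I_n}) (X : V) : V := Sub (s @: val X) (card_vact s X).

Lemma val_vact s X : val (vact s X) = s @: val X.
Proof. by rewrite SubK. Qed.

Lemma vact_inj s : injective (vact s).
Proof.
move=> X Y /(congr1 val); rewrite !val_vact => /(imset_inj (@perm_inj _ s)) h.
exact: val_inj.
Qed.

Lemma sum_vact (X Y : V) : \sum_(s : {perm 'I_n}) X_ (vact s X) * X_ (vact s Y)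
  = a #|val X :&: val Y|.
Proof.
rewrite -pairsumE ?card_val // /pairsum; apply: eq_bigr => s _.
by rewrite -!val_vact !setvar_val.
Qed.

Lemma subset_vert (Y : {set 'I_n}) : (#|Y| <= l)%N ->
  (0 < #|[set X : V | Y \subset val X]|)%N.
Proof.
move=> cY.
have [|A AY cA] := @subset_of_card _ (~: Y) (l - #|Y|).
  by have := cardsC Y; rewrite card_ord; lia.
have cX : #|Y :|: A| == l.
  rewrite cardsU (_ : Y :&: A = set0) ?cards0 ?cA ?subn0 ?subnKC //.
  by apply/eqP; rewrite setI_eq0 disjoint_sym disjoints_subset.
by apply/card_gt0P; exists (Sub (Y :|: A) cX : V); rewrite inE SubK subsetUl.
Qed.

Lemma card_vert_gt0 : (0 < #|{: V}|)%N.
Proof.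
have /card_gt0P[X _] := @subset_vert set0 ltac:(by rewrite cards0).
by apply/card_gt0P; exists X.
Qed.

Lemma card_perm_ord : #|{: {perm 'I_n}}| = n`!.
Proof. exact: card_Sn. Qed.

Section Adjacency.
Variables (alpha : rat) (m : nat).
Hypothesis ml : (m <= l)%N.
Hypothesis mE : (1 - alpha) * l%:R = m%:R.

Lemma jadjE (X Y : V) : jadj alpha X Y = (#|val X :&: val Y| == m).
Proof. by rewrite /jadj mE eqr_nat. Qed.

Lemma jadj_vact s (X Y : V) : jadj alpha (vact s X) (vact s Y) = jadj alpha X Y.
Proof.
rewrite !jadjE !val_vact -imsetI; last by move=> x y _ _; exact: perm_inj.
by rewrite card_imset //; exact: perm_inj.
Qed.

(** Keep [m] points of [X] and add [l - m] points outside it; [2 * l <= n] leaves room. So [AF]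
    divides by a nonzero degree. *)
Lemma card_jadj_gt0 (X : V) : (0 < #|[set Y : V | jadj alpha X Y]|)%N.
Proof.
have [|A AX cA] := @subset_of_card _ (val X) m; first by rewrite card_val.
have [|B BX cB] := @subset_of_card _ (~: val X) (l - m).
  by have := cardsC (val X); rewrite card_val card_ord; lia.
have XB : val X :&: B = set0.
  by apply/eqP; rewrite setI_eq0 disjoint_sym disjoints_subset.
have cY : #|A :|: B| == l.
  rewrite cardsU (_ : A :&: B = set0) ?cards0 ?cA ?cB ?subn0 ?subnKC //.
  by apply/eqP; rewrite -subset0 -XB setSI.
apply/card_gt0P; exists (Sub (A :|: B) cY : V).
by rewrite inE jadjE SubK setIUr XB setU0 (setIidPr AX) cA.
Qed.

(** The action preserves adjacency, so the degree can be taken at [X]: a scalar that leaves the sum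
    over [s]. *)
Lemma AF_vact s (X : V) : AF R alpha (vact s X)
  = #|[set Y : V | jadj alpha X Y]|%:R^-1 *: \sum_(Y : V | jadj alpha X Y) X_ (vact s Y).
Proof.
rewrite /AF mul_mpolyC; congr (_^-1 *: _).
  congr (_%:R); rewrite -[RHS](card_imset _ (@vact_inj s)); apply: eq_card => Y.
  apply/idP/imsetP => [|[Z]]; rewrite inE.
    have [Z ->] : exists Z, Y = vact s Z by exists (invF (@vact_inj s) Y); rewrite f_invF.
    by rewrite jadj_vact => h; exists Z; rewrite ?inE.
  by move=> h ->; rewrite inE jadj_vact.
rewrite (reindex_inj (@vact_inj s)) /=.
by apply: eq_bigl => Y; rewrite jadj_vact.
Qed.

(** Each [s] only permutes the vertices, so the [n!] copies of the mean can be reindexed, one by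
    each [s]; exchanging the sums puts the orbit sum [u] at every vertex. *)
Lemma EpiE (G : V -> P) (u : P) :
    (forall X, \sum_(s : {perm 'I_n}) G (vact s X) = u) ->
  n`!%:R *: Epi G = u.
Proof.
move=> h; rewrite /Epi mul_mpolyC scalerA mulrC -scalerA scaler_nat -card_perm_ord.
rewrite -[_ *+ #|{: {perm 'I_n}}|]sumr_const.
under eq_bigr => s _ do rewrite (reindex_inj (@vact_inj s)).
rewrite exchange_big /= (eq_bigr (fun=> u)) // sumr_const -scaler_nat scalerA.
by rewrite mulVf ?scale1r // pnatr_eq0 -lt0n card_vert_gt0.
Qed.

Lemma Epi_sqr : n`!%:R *: Epi (fun X => X_ X ^+ 2) = a l.
Proof.
apply: EpiE => X; have := sum_vact X X; rewrite setIid card_val => <-.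
by apply: eq_bigr => s _; rewrite expr2.
Qed.

Lemma Epi_AF : n`!%:R *: Epi (fun X => X_ X * AF R alpha X) = a m.
Proof.
apply: EpiE => X.
under eq_bigr => s _ do rewrite AF_vact -scalerAr big_distrr.
rewrite -scaler_sumr exchange_big /=.
rewrite (eq_bigr (fun=> a m)); last by move=> Y; rewrite sum_vact jadjE => /eqP->.
rewrite sumr_const -cardsE -scaler_nat scalerA mulVf ?scale1r //.
by rewrite pnatr_eq0 -lt0n card_jadj_gt0.
Qed.
End Adjacency.

Lemma delta_imset (s : {perm 'I_n}) (Y : {set 'I_n}) : delta R l (s @: Y)
  = #|[set X : V | Y \subset val X]|%:R^-1 *: \sum_(X : V | Y \subset val X) X_ (vact s X).
Proof.
have E (X : V) : (s @: Y \subset val (vact s X)) = (Y \subset val X).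
  rewrite val_vact; apply/idP/idP => [/subsetP h|]; last exact: imsetS.
  by apply/subsetP => y yY; have := h (s y) (imset_f _ yY); rewrite mem_imset //; exact: perm_inj.
rewrite /delta mul_mpolyC; congr (_^-1 *: _).
  congr (_%:R); rewrite -[RHS](card_imset _ (@vact_inj s)); apply: eq_card => X.
  apply/idP/imsetP => [|[Z]]; rewrite inE.
    have [Z ->] : exists Z, X = vact s Z by exists (invF (@vact_inj s) X); rewrite f_invF.
    by rewrite E => h; exists Z; rewrite ?inE.
  by move=> h ->; rewrite inE E.
rewrite (reindex_inj (@vact_inj s)) /=.
by apply: eq_bigl => Y'; rewrite E.
Qed.

Lemma Edelta2_linsos j : linsos (Edelta2 R n l j).
Proof.
rewrite /Edelta2 mul_mpolyC; apply: linsosZ; first by rewrite invr_ge0.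
apply: linsos_sum_sqr => Y _; rewrite /delta mul_mpolyC.
apply: leq_trans (msizeZ_le _ _) _; apply: msize_sum_le2 => X _.
by rewrite msize_Fv.
Qed.

(* [pi i] is the mean of ['C(#|U :&: U'|, i)] over [Y] and independent [U, U'] containing [Y], and
   [j <= #|U :&: U'| <= l]. *)
Lemma Edelta2_newton j : (j <= l)%N -> exists pi : nat -> R,
  n`!%:R *: Edelta2 R n l j = \sum_(i < l.+1) pi i *: D i 0%N
  /\ forall i, 'C(j, i)%:R <= pi i <= 'C(l, i)%:R.
Proof.
move=> jl.
pose up (Y : {set 'I_n}) := #|[set X : V | Y \subset val X]|.
pose e := #|[set Y : {set 'I_n} | #|Y| == j]|.
exists (fun i => e%:R^-1 * \sum_(Y : {set 'I_n} | #|Y| == j)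
  ((up Y)%:R^-1 * \sum_(U : V | Y \subset val U)
    ((up Y)%:R^-1 * \sum_(U' : V | Y \subset val U')
      'C(#|val U :&: val U'|, i)%:R))); split; last first.
  move=> i; apply: mean_bounds => [|Y /eqP cY]; first by rewrite card_draws card_ord bin_gt0; lia.
  have up0 : (0 < up Y)%N by apply: subset_vert; rewrite cY.
  apply: mean_bounds => // U YU; apply: mean_bounds => // U' YU'.
  rewrite !ler_nat !leq_bin2l //.
    exact: card_valI.
  by rewrite -cY subset_leq_card // subsetI YU.
under [RHS]eq_bigr => i _ do rewrite -scalerA scaler_suml.
rewrite -scaler_sumr exchange_big /=.
rewrite /Edelta2 mul_mpolyC scalerA mulrC -scalerA; congr (_ *: _).
rewrite scaler_nat -card_perm_ord -[_ *+ #|{: {perm 'I_n}}|]sumr_const.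
have inj (s : {perm 'I_n}) : injective (fun A : {set 'I_n} => s @: A).
  by apply: imset_inj; exact: (@perm_inj _ s).
under [LHS]eq_bigr => s _.
  rewrite (reindex_inj (inj s)) /=.
  rewrite (eq_bigl (fun Y : {set _} => #|Y| == j)); last first.
    by move=> Y /=; rewrite card_imset //; exact: perm_inj.
  over.
rewrite exchange_big /=; apply: eq_bigr => Y _.
under eq_bigr => s _ do rewrite delta_imset exprZn !expr2.
rewrite -scaler_sumr -scalerA.
under [RHS]eq_bigr => i _ do rewrite -scalerA scaler_suml.
rewrite -scaler_sumr exchange_big /=; congr (_ *: _).
rewrite scaler_sumr.
under [LHS]eq_bigr => s _ do rewrite mulr_suml scaler_sumr.
rewrite exchange_big /=; apply: eq_bigr => U YU.
under [RHS]eq_bigr => i _ do rewrite -scalerA scaler_suml.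
rewrite -!scaler_sumr; congr (_ *: _); rewrite [RHS]exchange_big /=.
under [LHS]eq_bigr => s _ do rewrite mulr_sumr.
rewrite exchange_big /=; apply: eq_bigr => U' YU'.
rewrite sum_vact (@newton_forward _ l).
  by apply: eq_bigr => i _; rewrite scaler_nat.
exact: card_valI.
Qed.
End JohnsonForms.

(** * Binomial inequalities *)

Lemma bin_mono_half (l i r : nat) : (i <= r)%N -> (2 * r <= l)%N -> ('C(l, i) <= 'C(l, r))%N.
Proof.
elim: r => [|r IH]; first by rewrite leqn0 => /eqP->.
rewrite leq_eqVlt => /orP[/eqP->//|]; rewrite ltnS => ir rl.
apply: leq_trans (IH ir _) _; first lia.
rewrite -(leq_pmul2l (ltn0Sn r)) mul_bin_left leq_mul2r; lia.
Qed.

(** The quotient of ['C(m, i)] by ['C(l, i)] is the product of the [(m - j) / (l - j)] for [j < i],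
    each at most [m / l]. *)
Lemma bin_pow_le (l m i : nat) : (m <= l)%N -> (i <= l)%N ->
  ('C(m, i) * l ^ i <= m ^ i * 'C(l, i))%N.
Proof.
move=> ml; elim: i => [|i IH] il; first by rewrite !bin0.
rewrite -(leq_pmul2l (ltn0Sn i)) mulnA mul_bin_left.
rewrite [X in (_ <= X)%N]mulnCA mul_bin_left !expnS.
have := IH (ltnW il) => h.
apply: (@leq_trans ((m - i) * l * (m ^ i * 'C(l, i)))%N).
  rewrite -mulnA [('C(m, i) * _)%N]mulnCA mulnA; exact: leq_mul.
rewrite [X in (_ <= X)%N]mulnACA leq_mul2r; apply/orP; right.
by rewrite mulnBl mulnBr leq_sub2l // [X in (_ <= X)%N]mulnC leq_mul2r ml orbT.
Qed.

(** The last factor of that product has index at least 1, hence is strictly below [m / l]. *)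
Lemma bin_pow_lt (l m i : nat) : (0 < m < l)%N -> (2 <= i <= l)%N ->
  ('C(m, i) * l ^ i < m ^ i * 'C(l, i))%N.
Proof.
move=> /andP[m0 ml] /andP[]; case: i => // i i1 il.
rewrite -(ltn_pmul2l (ltn0Sn i)) mulnA mul_bin_left.
rewrite [X in (_ < X)%N]mulnCA mul_bin_left !expnS.
have h := @bin_pow_le l m i (ltnW ml) (ltnW il).
apply: (@leq_ltn_trans ((m - i) * l * (m ^ i * 'C(l, i)))%N).
  rewrite -mulnA [('C(m, i) * _)%N]mulnCA mulnA; exact: leq_mul.
have pos : (0 < m ^ i * 'C(l, i))%N by rewrite muln_gt0 expn_gt0 m0 bin_gt0 ltnW.
have -> : (m * m ^ i * ((l - i) * 'C(l, i)) = m * (l - i) * (m ^ i * 'C(l, i)))%N.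
  by rewrite mulnACA.
rewrite ltn_pmul2r // mulnBl mulnBr.
(* The subtraction is truncated: for [m < i] the left side is [0]. *)
case: (ltnP m i) => im.
  rewrite (_ : m * l - i * l = 0)%N; last by apply/eqP; rewrite subn_eq0 leq_mul2r ltnW ?orbT.
  by rewrite -mulnBr muln_gt0 m0 subn_gt0.
have h1 : (m * i < i * l)%N by rewrite mulnC ltn_pmul2l.
have h2 : (m * i < m * l)%N by rewrite ltn_pmul2l.
lia.
Qed.

(** Multiplied by [l ^ r.+1], the difference is an integer; it is positive by [bin_pow_lt] and
    [m <= l], hence at least 1. *)
Lemma high_degree_gap (R : realFieldType) (l m i r : nat) :
    (0 < m < l)%N -> (2 <= i <= l)%N -> (r < i)%N ->
  (l%:R ^+ l.+1)^-1 <= (m%:R / l%:R) ^+ r.+1 * 'C(l, i)%:R - 'C(m, i)%:R :> R.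
Proof.
move=> ml il ri; have h := bin_pow_lt ml il.
have /andP[m0 lm] := ml; have /andP[i2 il'] := il.
have l0 : (0 < l)%N by exact: leq_ltn_trans lm.
have {}h : ('C(m, i) * l ^ r.+1 < m ^ r.+1 * 'C(l, i))%N.
  rewrite -(@ltn_pmul2r (l ^ (i - r.+1))) ?expn_gt0 ?l0 //.
  rewrite -mulnA -expnD subnKC //; apply: leq_trans h _.
  rewrite mulnAC leq_mul2r; apply/orP; right.
  rewrite -{1}(subnKC ri) expnD leq_mul2l; apply/orP; right.
  by case: (i - r.+1)%N => // k; rewrite leq_exp2r // ltnW.
have l0' : (0 : R) < l%:R ^+ r.+1 by rewrite exprn_gt0 // ltr0n.
apply: (@le_trans _ _ ((l%:R ^+ r.+1)^-1)).
  rewrite lef_pV2 ?posrE ?exprn_gt0 ?ltr0n //.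
  by apply: ler_weXn2l; rewrite ?ler1n //; lia.
rewrite expr_div_n mulrAC -(ler_pM2r l0') mulVf ?gt_eqF // mulrBl divfK ?gt_eqF //.
by rewrite -!natrX -!natrM lerBrDr nat1r ler_nat.
Qed.

(** * Coefficients *)

Section Coefficients.
Variables (R : realFieldType) (l m r : nat) (pi : nat -> R).
Hypothesis ml : (0 < m < l)%N.
Hypothesis rl : (2 * r <= l)%N.
Hypothesis piP : forall i, 'C(r, i)%:R <= pi i <= 'C(l, i)%:R.

Local Notation x := (m%:R / l%:R : R).
Local Notation kappa := (1 - x ^+ r.+1).

(* Here [x = 1 - alpha] and [m = (1 - alpha) l]. *)
Definition newton_coef (i : nat) : R :=
  x ^+ r.+1 * 'C(l, i)%:R - 'C(m, i)%:R + kappa * (8 ^+ r * 'C(l, r)%:R) * pi i.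

(** This bound and the next depend on [l] alone, which makes the threshold on [n] uniform in [alpha]
    and [r]. *)
Definition coef_gap : R := (l%:R ^+ l.+1)^-1.
Definition coef_max : R := 2 ^+ l + 8 ^+ l * 2 ^+ l * 2 ^+ l.

Let l_gt0 : (0 : R) < l%:R.
Proof. by rewrite ltr0n; case/andP: ml => _; exact: leq_ltn_trans. Qed.

Let x_ge0 : 0 <= x. Proof. by rewrite divr_ge0. Qed.

Let x_le1 : x <= 1.
Proof. by rewrite ler_pdivrMr // mul1r ler_nat ltnW //; case/andP: ml. Qed.

Let pi_ge0 i : 0 <= pi i.
Proof. by have /andP[h _] := piP i; apply: le_trans h. Qed.

Let kappa_ge : coef_gap <= kappa.
Proof.
have /andP[_ lm] := ml.
apply: (@le_trans _ _ (l%:R^-1)).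
  rewrite lef_pV2 ?posrE ?exprn_gt0 // -{1}[l%:R]expr1.
  by apply: ler_weXn2l; rewrite // ler1n -(ltr0n R).
apply: (@le_trans _ _ (1 - x)); last by rewrite lerD2l lerN2 ler_iXnr.
rewrite -(ler_pM2r l_gt0) mulVf ?gt_eqF // mulrBl divfK ?gt_eqF // mul1r.
by rewrite lerBrDr nat1r ler_nat.
Qed.

Let gap_gt0 : 0 < coef_gap.
Proof. by rewrite invr_gt0 exprn_gt0. Qed.

Let kappa_ge0 : 0 <= kappa.
Proof. by apply: le_trans kappa_ge; exact: ltW. Qed.

(* For [i <= r] the factor [8 ^ r] gives the gap, and for [r < i] the strict inequality
   ['C(m, i) / 'C(l, i) < (m / l) ^ i] does; it needs [2 <= i]. *)
Lemma newton_coef_ge i : (1 < i <= l)%N || (i <= r)%N && (0 < r)%N ->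
  coef_gap <= newton_coef i.
Proof.
have /andP[m0 lm] := ml => hi.
have [ir|ri] := leqP i r; last first.
  have il : (2 <= i <= l)%N by lia.
  apply: le_trans (high_degree_gap R ml il ri) _.
  by rewrite lerDl !mulr_ge0 ?exprn_ge0.
have r0 : (0 < r)%N by lia.
have il : (i <= l)%N by lia.
have C1 : (1 : R) <= 'C(l, i)%:R by rewrite ler1n bin_gt0.
have Cml : 'C(m, i)%:R <= 'C(l, i)%:R :> R by rewrite ler_nat leq_bin2l // ltnW.
(* The first two terms of the coefficient lose at most [kappa * 'C(l, i)], against a gain of at
   least eight times that. *)
have big : 8 * 'C(l, i)%:R <= 8 ^+ r * 'C(l, r)%:R * pi i.
  rewrite -[X in X <= _]mulr1; apply: ler_pM => //; rewrite ?mulr_ge0 //.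
    apply: ler_pM => //; last by rewrite ler_nat bin_mono_half.
    by rewrite -{1}[8]expr1; apply: ler_weXn2l => //; lra.
  by have /andP[h _] := piP i; apply: le_trans h; rewrite ler1n bin_gt0.
have := ler_wpM2l kappa_ge0 big; rewrite mulrA /newton_coef.
have := ler_wpM2l kappa_ge0 C1; move: kappa_ge kappa_ge0 Cml.
set y := x ^+ _; set c := _%:R; set c' := _%:R; set w := _ * pi i.
rewrite !mulrA; set v := _ * pi i; move=> *; lra.
Qed.

Lemma newton_coef_le i : newton_coef i <= coef_max.
Proof.
have two j : 'C(l, j)%:R <= 2 ^+ l :> R by rewrite -natrX ler_nat bin_le_exp2.
have x1 : 0 <= x ^+ r.+1 <= 1 by rewrite exprn_ge0 //= exprn_ile1.
have /andP[x10 x11] := x1.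
have h1 : x ^+ r.+1 * 'C(l, i)%:R <= 2 ^+ l.
  by rewrite -[X in _ <= X]mul1r; apply: ler_pM.
have h2 : kappa * (8 ^+ r * 'C(l, r)%:R) * pi i <= 8 ^+ l * 2 ^+ l * 2 ^+ l.
  apply: ler_pM; rewrite ?mulr_ge0 ?exprn_ge0 //.
    rewrite -[X in _ <= X]mul1r; apply: ler_pM; rewrite ?mulr_ge0 ?exprn_ge0 //.
      by move: x10; lra.
    by apply: ler_pM; rewrite ?exprn_ge0 //; apply: ler_weXn2l; [lra | lia].
  by have /andP[_ h] := piP i; apply: le_trans h _.
have h3 : (0 : R) <= 'C(m, i)%:R by [].
rewrite /newton_coef /coef_max.
by apply: lerD => //; move: h1 h3; lra.
Qed.

(** Both bounds on [pi 0] equal 1, and [x - 1 + (1 - x) = 0]. *)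
Lemma newton_coef00 : r = 0%N -> newton_coef 0 = 0.
Proof.
move=> r0; have := piP 0; rewrite /newton_coef r0 !bin0 => /le_anti <-.
by rewrite !mulr1 expr1; ring.
Qed.

(** The first two terms cancel since [x * l = m]. *)
Lemma newton_coef01_ge0 : r = 0%N -> 0 <= newton_coef 1.
Proof.
move=> r0; rewrite /newton_coef r0 !bin1 expr1 divfK ?gt_eqF // subrr add0r.
by rewrite !mulr_ge0 // subr_ge0.
Qed.
End Coefficients.

(** * Assembly of the certificate *)

Lemma Epi_sub (R : realType) (n l : nat) (G H : vert n l -> {mpoly R[nvert n l]}) :
  Epi (fun X => G X - H X) = Epi G - Epi H.
Proof. by rewrite /Epi sumrB mulrBr. Qed.

Lemma eq_Epi (R : realType) (n l : nat) (G H : vert n l -> {mpoly R[nvert n l]}) :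
  G =1 H -> Epi G = Epi H.
Proof. by move=> GH; rewrite /Epi (eq_bigr _ (fun X _ => GH X)). Qed.

(** With [c = 0] the two occurrences of the mean of [F] in [rhs] cancel, so a homogeneous quadratic
    form is left. *)
Lemma dirichlet_subE (R : realType) (alpha : rat) (n l r : nat) :
  let y := (1 - ratr alpha) ^+ r.+1 : R in
  dirichlet R alpha n l - rhs R alpha n l 0 r =
  y *: Epi (fun X => Fv R X ^+ 2) - Epi (fun X => Fv R X * AF R alpha X)
  + ((1 - y) * (8 ^+ r * 'C(l, r)%:R)) *: \sum_(j < r.+1) Edelta2 R n l j.
Proof.
move=> y; rewrite /dirichlet /rhs mul0r subr0 mpolyC1 mul1r Epi_sub !mul_mpolyC.
rewrite (@eq_Epi _ _ _ _ (fun X => Fv R X ^+ 2 - Fv R X * AF R alpha X)); last first.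
  by move=> X; rewrite mulrBr expr2.
rewrite Epi_sub -/y -[in RHS]scalerA; set S := _ *: \sum_(j < _) _.
set E2 := Epi (fun X => Fv R X ^+ 2); set EA := Epi _; set E1 := Epi _.
rewrite (_ : E1 - S + (E2 - E1) = E2 - S); last first.
  by rewrite addrC addrA addrNK.
by rewrite scalerBr !scalerBl !scale1r opprB addrC; ring.
Qed.

Lemma linsos_dirichlet (R : realType) (alpha : rat) (n l m r K : nat) :
    0 < alpha < 1 -> (1 - alpha) * l%:R = m%:R -> (l == 0) || (0 < m < l)%N ->
    (2 * r <= l)%N -> (4 + 2 * l + K.+1 * l <= n)%N -> (0 < K)%N ->
    ((0 < l)%N -> l.+1%:R * coef_max R l * 2 ^+ l * 2 ^+ l.+1 <= K%:R * coef_gap R l) ->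
  linsos (dirichlet R alpha n l - rhs R alpha n l 0 r).
Proof.
move=> /andP[a0 a1] mE mlP rl hn K0 big.
have ln : (2 * l <= n)%N by lia.
have ml : (m <= l)%N.
  case/orP: mlP => [/eqP l0|/andP[_ /ltnW]//].
  by rewrite -(ler_nat rat) -mE l0 mulr0.
have F2 : forall A, (msize (@setvar R n l A) <= 2)%N := @msize_setvar R n l.
have f0 : (0 : R) < n`!%:R by rewrite ltr0n fact_gt0.
have -> : dirichlet R alpha n l - rhs R alpha n l 0 r =
    n`!%:R^-1 *: (n`!%:R *: (dirichlet R alpha n l - rhs R alpha n l 0 r)).
  by rewrite scalerA mulVf ?scale1r // gt_eqF.
apply: linsosZ; first by rewrite invr_ge0.
have [|pi [piE piP]] := @Edelta2_newton R n l ln r; first lia.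
(* The term [j = r] provides the [pi] of [newton_coef]; the lower levels enter the certificate
   directly as squares. *)
rewrite dirichlet_subE big_ord_recr /=.
set y := (1 - ratr alpha) ^+ r.+1; set B : R := 8 ^+ r * _.
have /andP[y0 y1] : 0 <= y <= 1.
  have ra0 : (0 : R) <= ratr alpha by rewrite ler0q ltW.
  have ra1 : ratr alpha <= 1 :> R by rewrite -[1](rmorph1 (@ratr R)) ler_rat ltW.
  by rewrite exprn_ge0 ?subr_ge0 //= exprn_ile1 ?subr_ge0 // gerBl.
pose a := paircor l (@setvar R n l).
have -> : n`!%:R *: (y *: Epi (fun X : vert n l => Fv R X ^+ 2)
      - Epi (fun X => Fv R X * AF R alpha X)
    + ((1 - y) * B) *: (\sum_(i < r) Edelta2 R n l i + Edelta2 R n l r))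
  = (y *: a l - a m + ((1 - y) * B) *: \sum_(i < l.+1) pi i *: iter i (@fdiff _) a 0%N)
    + n`!%:R *: (((1 - y) * B) *: \sum_(i < r) Edelta2 R n l i).
  rewrite -piE /a -(@Epi_sqr R n l ln) -(@Epi_AF R n l ln alpha m ml mE).
  by rewrite scalerDr scalerBr !scalerDr !scalerA ![_ * n`!%:R]mulrC; ring.
have yB : 0 <= (1 - y) * B by rewrite !mulr_ge0 ?exprn_ge0 // subr_ge0.
apply: linsosD; last first.
  apply: linsosZ; rewrite ?ler0n //; apply: linsosZ => //.
  by apply: (cone_sum (@linsosD R _) (linsos0 _ _)) => i _; exact: Edelta2_linsos.
(* For [l = 0] only [a 0] occurs, with coefficient [y - 1 + (1 - y) = 0]. *)
case/orP: mlP => [/eqP l0|mlP].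
  have r0 : r = 0%N by lia.
  have m0 : m = 0%N by lia.
  subst r m l; have := piP 0%N; rewrite !bin0 => /le_anti pi0.
  rewrite big_ord_recl big_ord0 addr0 /= -pi0 scale1r /B expr0 bin0 !mulr1.
  by rewrite [(1 - y) *: _]scalerBl scale1r subrKA subrr; exact: linsos0.
have {}big := big ltac:(lia).
have l0 : (l%:R : R) != 0 by rewrite pnatr_eq0; lia.
have yE : y = (m%:R / l%:R) ^+ r.+1.
  rewrite /y; congr (_ ^+ _).
  by rewrite -[m%:R](ratr_nat R m) -mE rmorphM rmorphB rmorph1 /= ratr_nat mulfK.
have -> : y *: a l - a m + ((1 - y) * B) *: \sum_(i < l.+1) pi i *: iter i (@fdiff _) a 0%N
   = \sum_(i < l.+1) newton_coef l m r pi i *: iter i (@fdiff _) a 0%N.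
  rewrite {1}(newton_forward a (leqnn l)) {1}(newton_forward a ml).
  rewrite !scaler_sumr -sumrB -big_split; apply: eq_bigr => i _ /=.
  by rewrite /newton_coef -yE scalerDl scalerBl -!scalerA !scaler_nat.
have cube j : (j <= l)%N -> linsos (iter j (@fdiff _) a 0%N *+ K + iter j (@fdiff _) a (l - j)%N).
  by move=> jl; apply: linsos_fdiff_blocks => //; lia.
(* The orders [s = 0] and [s = 2] serve as bases below; [s = 2] accounts for the 4 in the bound on
   [n]. *)
have top s t : (s <= 2)%N -> (s <= l)%N -> (t <= l - s)%N ->
    linsos (iter s (@fdiff _) a (l - s)%N - iter s (@fdiff _) a t) /\
    linsos (iter s (@fdiff _) a (l - s)%N + iter s (@fdiff _) a t).
  by move=> *; apply: linsos_fdiff_top => //; lia.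
have gap0 : 0 < coef_gap R l by rewrite invr_gt0 exprn_gt0 // ltr0n; lia.
have LD := @linsosD R (nvert n l); have LZ := @linsosZ R (nvert n l).
have L0 := linsos0 R (nvert n l).
(* For [0 < r] the base is [a l]; the surplus split off by [positive_form] is itself in the cone and
   is added back. *)
case: (posnP r) => r0; last first.
  have -> : \sum_(i < l.+1) newton_coef l m r pi i *: iter i (@fdiff _) a 0%N
     = (\sum_(i < (l - 0).+1) newton_coef l m r pi i *: iter (i + 0) (@fdiff _) a 0%N
        - (coef_gap R l / 2 ^+ l.+1) *: a l) + (coef_gap R l / 2 ^+ l.+1) *: a l.
    by rewrite subrK subn0; apply: eq_bigr => i _; rewrite addn0.
  apply: linsosD; last first.
    apply: linsosZ; first by rewrite divr_ge0 ?exprn_ge0 // ltW.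
    by have := base_cone LZ (fun t => top 0 t isT isT); rewrite subn0.
  have := @positive_form _ _ _ LD LZ L0 l K a cube 0 isT (fun t => top 0 t isT isT)
    (newton_coef l m r pi) (coef_gap R l) (coef_max R l) K0 gap0.
  rewrite !subn0; apply => // i il; rewrite newton_coef_le // andbT.
  by apply: newton_coef_ge => //; lia.
have l2 : (2 <= l)%N by lia.
apply: (@positive_form2 _ _ _ LD LZ L0 l K a cube (newton_coef l m r pi) _ _ l2
   (fun t => top 2 t isT l2) K0 gap0 _ _ _ big).
- exact: newton_coef00.
- by rewrite newton_coef01_ge0 //= newton_coef_le.
- by move=> i il; rewrite newton_coef_le // andbT; apply: newton_coef_ge => //; lia.
Qed.

Lemma sos_proof_linsos (R : realType) (k : nat) (ax : seq {mpoly R[k]}) (g h : {mpoly R[k]}) :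
  linsos (g - h) ->
  sos_proof 2 ax g h /\ forall x : 'I_k -> R, meval x h <= meval x g.
Proof.
move=> [s hs E]; split; last first.
  move=> x; rewrite -subr_ge0 -mevalB E rmorph_sum sumr_ge0 // => q _.
  by rewrite rmorphXn /= sqr_ge0.
exists (\sum_(q <- s) q ^+ 2), (nseq (size ax) 0); split.
- by rewrite size_nseq.
- split; first by exists s.
  by move=> i; exists [::]; rewrite big_nil nth_nseq if_same.
- by rewrite E [X in _ + X]big1 ?addr0 // => i _; rewrite nth_nseq if_same mul0r.
- elim: s hs {E} => [|q s IH] /=; first by rewrite big_nil msize0.
  move=> /andP[hq hs]; rewrite big_cons; apply: leq_trans (msizeD_le _ _) _.
  rewrite geq_max IH // andbT.
  (* The size of a product is additive, up to one, only for nonzero factors. *)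
  have [->|q0] := eqVneq q 0; first by rewrite expr0n msize0.
  by rewrite expr2 msizeM //; case: (msize q) hq => [|[|[|]]].
- by move=> i; rewrite nth_nseq if_same mul0r msize0.
Qed.

Theorem theorem5p4 (R : realType) (l : nat) :
  exists c : R,
  forall alpha : rat, 0 < alpha < 1 / 2 ->
  (exists m : nat, alpha * l%:R = m%:R) ->
  exists n0 : nat, forall n : nat, (n0 <= n)%N ->
  forall r : nat, (2 * r <= l)%N ->
    sos_proof 2 (box_axioms R n l) (dirichlet R alpha n l) (rhs R alpha n l c r)
    /\ (forall x : 'I_(nvert n l) -> R, (forall i, 0 <= x i <= 1) ->
          meval x (rhs R alpha n l c r) <= meval x (dirichlet R alpha n l)).
Proof.
exists 0 => alpha /andP[a0 ah] [b bE].
have a1 : alpha < 1 by apply: lt_trans ah _; lra.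
have bl : (b <= l)%N by rewrite -(ler_nat rat) -bE ler_piMl // ltW.
pose E : R := l.+1%:R * coef_max R l * 2 ^+ l * 2 ^+ l.+1.
(* [Num.bound] makes the errors of order [1 / K] smaller than the gap allows; the successor makes
   [K] positive. *)
pose K := (Num.bound (E / coef_gap R l)).+1.
have big : (0 < l)%N -> E <= K%:R * coef_gap R l.
  move=> l0; have gap0 : 0 < coef_gap R l by rewrite invr_gt0 exprn_gt0 // ltr0n.
  have E0 : 0 <= E / coef_gap R l.
    have M0 : 0 <= coef_max R l by rewrite addr_ge0 ?mulr_ge0 ?exprn_ge0.
    by rewrite divr_ge0 ?(ltW gap0) ?mulr_ge0 ?exprn_ge0.
  rewrite -ler_pdivrMr //; apply: ltW; apply: lt_le_trans (archi_boundP E0) _.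
  by rewrite ler_nat.
exists (4 + 2 * l + K.+1 * l)%N => n hn r rl.
have [] := sos_proof_linsos (box_axioms R n l)
  (linsos_dirichlet (alpha := alpha) (m := l - b) (K := K) _ _ _ rl hn isT big).
- by rewrite a0.
- by rewrite mulrBl mul1r bE natrB.
(* For [0 < l], [0 < alpha < 1] gives [0 < b < l], hence the same for [m = l - b]. *)
- case: (posnP l) => //= l0; have lr : (0 : rat) < l%:R by rewrite ltr0n.
  have b0 : (0 < b)%N by rewrite -(ltr_nat rat) -bE mulr_gt0.
  have : (b < l)%N by rewrite -(ltr_nat rat) -bE gtr_pMl.
  lia.
- by move=> h1 h2; split.
Qed.
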